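(* Let $\mu$ be a probability distribution on $(E,\mathscr{E})$, $\xi:E\to E$ a measurable involution with $\mu\circ\xi^{-1}=\mu$ and $Qf=f\circ\xi$ the associated isometric involution, and $\psi:E\to E$ a measurable bijection with $\psi^{-1}=\xi\circ\psi\circ\xi$. Let $\nu:=\mu+\mu^{\xi\circ\psi}$ and $r(z):=\frac{{\rm d}\mu^{\xi\circ\psi}/{\rm d}\nu(z)}{{\rm d}\mu/{\rm d}\nu(z)}$ when both derivatives are positive, $r(z)=0$ otherwise. For $i\in\{1,2\}$ let $\phi_{i}:\mathbb{R}_{+}\to[0,1]$ satisfy $r\phi_{i}(r^{-1})=\phi_{i}(r)$ for $r>0$ and $\phi_{i}(0)=0$, and let \[P_{i,2}(z,{\rm d}z'):=\phi_{i}\circ r(z)\,\delta_{\psi(z)}({\rm d}z')+\big[1-\phi_{i}\circ r(z)\big]\delta_{\xi(z)}({\rm d}z').\] Let $P_{1,1}=P_{2,1}$ be a $(\mu,Q)$-reversible Markov transition. Assume $\phi_{1}\geq\phi_{2}$. Then for any $f\in L^{2}(\mu)$ with $Qf=f$ and any $\lambda\in[0,1)$, \[{\rm var}_{\lambda}(f,\{P_{1,1},P_{1,2}\})\leq{\rm var}_{\lambda}(f,\{P_{2,1},P_{2,2}\}).\] In particular, among all such $\phi$, the choice $\phi(r)=\min\{1,r\}$ achieves the smallest $\lambda$-asymptotic variance.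
   Context: $\mu^{\varphi}(A):=\mu(\varphi^{-1}(A))$; $\langle f,g\rangle_{\mu}=\int fg\,{\rm d}\mu$. A Markov kernel $P$ is $(\mu,Q)$-reversible if $\langle Pf,g\rangle_{\mu}=\langle f,QPQg\rangle_{\mu}$ for all $f,g\in L^{2}(\mu)$. With $\bar f=f-\mu(f)$ and $\lambda\in[0,1)$, ${\rm var}_{\lambda}(f,\{P_{1},P_{2}\})=\sum_{k\geq0}\big[\lambda^{2k}\langle\bar f,(P_{1}P_{2})^{k}({\rm Id}+\lambda P_{1})\bar f\rangle_{\mu}+\lambda^{2k}\langle\bar f,(P_{2}P_{1})^{k}({\rm Id}+\lambda P_{2})\bar f\rangle_{\mu}\big]-\|\bar f\|_{\mu}^{2}$. *)

(* Defs.v *)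
From HB Require Import structures.
From mathcomp Require Import all_boot all_order all_algebra.
From mathcomp Require Import all_classical all_reals all_analysis.
Set Implicit Arguments. Unset Strict Implicit. Unset Printing Implicit Defensive.
Import Order.TTheory GRing.Theory Num.Theory.
Import numFieldNormedType.Exports.
Local Open Scope classical_set_scope.
Local Open Scope ring_scope.

Section defs.
Context d (E : measurableType d) (R : realType).

Definition inner (mu : {measure set E -> \bar R}) (f g : E -> R) : R :=
  fine (\int[mu]_x (f x * g x)%:E).

Definition mean (mu : {measure set E -> \bar R}) (f : E -> R) : R :=
  fine (\int[mu]_x (f x)%:E).

Definition L2 (mu : {measure set E -> \bar R}) (f : E -> R) : Prop :=
  measurable_fun [set: E] f /\ mu.-integrable [set: E] (fun x => ((f x) ^+ 2)%:E).

Definition Qop (xi : E -> E) (f : E -> R) : E -> R := f \o xi.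

Definition kop (k : R.-pker E ~> E) (f : E -> R) : E -> R :=
  fun x => fine (\int[k x]_y (f y)%:E).

Definition reversible (mu : {measure set E -> \bar R}) (xi : E -> E)
  (P : (E -> R) -> (E -> R)) : Prop :=
  forall f g, L2 mu f -> L2 mu g ->
    inner mu (P f) g = inner mu f (Qop xi (P (Qop xi g))).

(* r(z) = (dmu^{xi o psi}/dnu)(z) / (dmu/dnu)(z) if both positive, 0 otherwise;
   g1 = dmu/dnu, g2 = dmu^{xi o psi}/dnu *)
Definition rratio (g1 g2 : E -> R) (z : E) : R :=
  if (0 < g1 z) && (0 < g2 z) then g2 z / g1 z else 0.

Definition P2op (phi : R -> R) (xi psi : E -> E) (rr : E -> R)
  (f : E -> R) : E -> R :=
  fun z => phi (rr z) * f (psi z) + (1 - phi (rr z)) * f (xi z).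

Definition varl (mu : {measure set E -> \bar R}) (lam : R)
  (P1 P2 : (E -> R) -> (E -> R)) (f : E -> R) : R :=
  let fb := fun x => f x - mean mu f in
  limn (fun n => \sum_(0 <= k < n)
     (lam ^+ (2 * k) * inner mu fb (iter k (P1 \o P2) (fun x => fb x + lam * P1 fb x))
    + lam ^+ (2 * k) * inner mu fb (iter k (P2 \o P1) (fun x => fb x + lam * P2 fb x))))
  - inner mu fb fb.

End defs.

Definition admissible (R : realType) (phi : R -> R) : Prop :=
  measurable_fun (`[0%R, +oo[%classic : set R) phi /\
  (forall r, 0 <= r -> 0 <= phi r <= 1) /\
  (forall r, 0 < r -> r * phi r^-1 = phi r) /\
  phi 0 = 0.

Definition minphi (R : realType) (r : R) : R := Num.min 1 r.

(* Main.v *)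
Require Import Defs.
From HB Require Import structures.
From mathcomp Require Import all_boot all_order all_algebra.
From mathcomp Require Import all_classical all_reals all_analysis.
From mathcomp Require Import measurable_realfun ring lra.
Set Implicit Arguments. Unset Strict Implicit. Unset Printing Implicit Defensive.
Import Order.TTheory GRing.Theory Num.Theory.
Import numFieldNormedType.Exports.
Local Open Scope classical_set_scope.
Local Open Scope ring_scope.

(** The alternating powers of [P1] and [P2] are the powers of the single operator
    [pair_op : (x, y) |-> (P1 y, P2 x)] on [L2 * L2], so the [lam]-asymptotic
    variance is [<F, (1 - lam pair_op)^-1 F> - |fb|^2] with [F = (fb, fb)].  With
    the isometric involution [J (x, y) = (Q y, Q x)], which fixes [F], the operator
    [J pair_op = (Q P2) (+) (Q P1)] is a self-adjoint contraction [D], whence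
    [<F, (1 - lam pair_op)^-1 F> = <F, (J - lam D)^-1 F>].  This number is the
    saddle value of [2 <F, x> - <x, J x> + lam <x, D x>], which is concave on the
    [J]-invariant vectors and convex on the anti-invariant ones, and the functional
    is nondecreasing in [D].  The quadratic form of [Q P2] is [|x|^2] minus half the
    integral of [phi(r) (x \o xi - x \o psi)^2], hence nonincreasing in [phi].
    Working with partial Neumann sums and errors of order [lam ^+ N] avoids the
    completeness of [L2]. *)

(** * Comparison of truncated Neumann series through a saddle functional *)

Section saddle_point.
Context (R : realType) (V : lmodType R) (L : V -> Prop) (B : V -> V -> R).
Context (J : V -> V).
Hypothesis L0 : L 0.
Hypothesis LD : forall x y, L x -> L y -> L (x + y).
Hypothesis LZ : forall (a : R) x, L x -> L (a *: x).
Hypothesis Bsym : forall x y, L x -> L y -> B x y = B y x.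
Hypothesis BDl : forall x y z, L x -> L y -> L z -> B (x + y) z = B x z + B y z.
Hypothesis BZl : forall a x z, L x -> L z -> B (a *: x) z = a * B x z.
Hypothesis B_ge0 : forall x, L x -> 0 <= B x x.
Hypothesis JD : forall x y, J (x + y) = J x + J y.
Hypothesis JZ : forall a x, J (a *: x) = a *: J x.
Hypothesis JK : involutive J.
Hypothesis LJ : forall x, L x -> L (J x).
Hypothesis BJ : forall x y, L x -> L y -> B (J x) (J y) = B x y.

(** [P] is a bare function, because a kernel operator on functions is additive only up to null sets.
    The middle clause amounts to symmetry of [J \o P] for [B]. *)
Definition reversible_contraction (P : V -> V) : Prop :=
  [/\ forall x, L x -> L (P x),
      forall x y, L x -> L y -> B (P x) y = B x (J (P (J y))) &
      forall x, L x -> B (P x) (P x) <= B x x].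

(** Truncated Neumann series of [(1 - lam P)^-1 F]. *)
Definition resolvent_sum (lam : R) (P : V -> V) (F : V) (N : nat) : V :=
  \sum_(k < N) lam ^+ k *: iter k P F.

(** The form of [J - lam D] with [D = J \o P]. It is linear in [x] by construction; additivity in
    [z] comes from the symmetry [saddle_formC]. *)
Definition saddle_form (lam : R) (P : V -> V) (x z : V) : R :=
  B x (J z) - lam * B x (J (P z)).

Let LN x : L x -> L (- x).
Proof. by move=> Lx; rewrite -scaleN1r; exact: LZ. Qed.

Let LB x y : L x -> L y -> L (x - y).
Proof. by move=> Lx Ly; apply: LD => //; exact: LN. Qed.

Let BDr x y z : L x -> L y -> L z -> B x (y + z) = B x y + B x z.
Proof. by move=> *; rewrite Bsym ?BDl// 1?(@Bsym y)// 1?(@Bsym z)//; exact: LD. Qed.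

Let BZr a x z : L x -> L z -> B x (a *: z) = a * B x z.
Proof. by move=> *; rewrite Bsym ?BZl// 1?(@Bsym z)//; exact: LZ. Qed.

Let BNl x z : L x -> L z -> B (- x) z = - B x z.
Proof. by move=> *; rewrite -scaleN1r BZl// mulN1r. Qed.

Let BNr x z : L x -> L z -> B x (- z) = - B x z.
Proof. by move=> *; rewrite -scaleN1r BZr// mulN1r. Qed.

Let B0l z : L z -> B 0 z = 0.
Proof. by move=> Lz; rewrite -(scale0r 0) BZl// mul0r. Qed.

Let B0r z : L z -> B z 0 = 0.
Proof. by move=> Lz; rewrite Bsym// B0l. Qed.

Let JN x : J (- x) = - J x.
Proof. by rewrite -scaleN1r JZ scaleN1r. Qed.

Let BJl x y : L x -> L y -> B (J x) y = B x (J y).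
Proof. by move=> Lx Ly; rewrite -{1}(JK y) BJ//; exact: LJ. Qed.

(** A weak Cauchy-Schwarz inequality: nonnegativity of the form at [x + y] and [x - y] gives
    [2 |B x y| <= B x x + B y y]. *)
Lemma form_norm_le (c : R) x y : L x -> L y -> B x x <= c -> B y y <= c ->
  `|B x y| <= c.
Proof.
move=> Lx Ly xc yc.
have := B_ge0 (LD Lx Ly); have := B_ge0 (LB Lx Ly).
rewrite !(BDl, BDr, BNl, BNr)//; try (by apply: LN); try (by apply: LD).
  2: by apply: LB.
by rewrite (@Bsym y x)// ler_norml; lra.
Qed.

Section one_operator.
Variables (P : V -> V) (F : V) (lam : R).
Hypothesis PP : reversible_contraction P.
Hypothesis LF : L F.
Hypothesis lam01 : 0 <= lam < 1.

Let LP x : L x -> L (P x). Proof. by case: PP => + _ _; exact. Qed.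

Let BP x y : L x -> L y -> B (P x) y = B x (J (P (J y))).
Proof. by case: PP => _ + _; exact. Qed.

Let P_le x : L x -> B (P x) (P x) <= B x x.
Proof. by case: PP => _ _; exact. Qed.

Lemma iter_mem k : L (iter k P F).
Proof. by elim: k => //= k; exact: LP. Qed.

Lemma iter_form_le k : B (iter k P F) (iter k P F) <= B F F.
Proof. by elim: k => //= k; apply: le_trans; apply/P_le/iter_mem. Qed.

Lemma resolvent_sum_mem N : L (resolvent_sum lam P F N).
Proof. by apply: big_ind => // i _; apply/LZ/iter_mem. Qed.

Lemma saddle_formC x z : L x -> L z -> saddle_form lam P x z = saddle_form lam P z x.
Proof.
move=> Lx Lz; rewrite /saddle_form -BJl// Bsym//; last exact: LJ.
rewrite -(@BJl x)//; last exact: LP.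
rewrite (@Bsym (J x)); [|exact: LJ|exact: LP].
by rewrite BP ?JK//; exact: LJ.
Qed.

Lemma saddle_formDl x y z : L x -> L y -> L z ->
  saddle_form lam P (x + y) z = saddle_form lam P x z + saddle_form lam P y z.
Proof.
move=> Lx Ly Lz; rewrite /saddle_form !BDl//; [ring| |]; apply: LJ => //.
exact: LP.
Qed.

(** The truncated series solves [(J - lam D) x = F] up to one remainder. The sum telescopes, since
    reversibility gives [B (iter k P F) (J (P z)) = B (iter k.+1 P F) (J z)]. *)
Lemma saddle_form_resolvent N z : L z -> (forall y, L y -> B F (J y) = B F y) ->
  saddle_form lam P (resolvent_sum lam P F N) z
  = B F z - lam ^+ N * B (iter N P F) (J z).
Proof.
move=> Lz JF; elim: N => [|N IH].
  rewrite /resolvent_sum big_ord0 /saddle_form !B0l ?JF//; first by ring.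
  by apply/LJ/LP. by apply/LJ.
have LPN := iter_mem N.
rewrite /resolvent_sum big_ord_recr -/(resolvent_sum lam P F N) /=.
rewrite saddle_formDl ?IH//; last by exact: LZ. 2: exact: resolvent_sum_mem.
rewrite /saddle_form !BZl//; [|by apply/LJ/LP|by apply/LJ].
by rewrite (@BP (iter N P F))// ?JK ?exprS; [ring|exact: LJ].
Qed.

(** Iterates of a contraction stay below [B F F], so the [k]-th pairing is at most
    [lam ^+ k * B F F]; the geometric series makes the bound uniform in [N]. *)
Lemma form_resolvent_sum_le N p : L p -> B p p <= B F F ->
  `|B p (resolvent_sum lam P F N)| <= (1 - lam)^-1 * B F F.
Proof.
move=> Lp pF; have /andP[lam0 lam1] := lam01.
have -> : B p (resolvent_sum lam P F N) = \sum_(k < N) lam ^+ k * B p (iter k P F).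
  elim: N => [|N IH]; first by rewrite /resolvent_sum !big_ord0 B0r.
  rewrite /resolvent_sum !big_ord_recr -/(resolvent_sum lam P F N) /=.
  rewrite BDr ?IH ?BZr//; try exact: iter_mem; try exact: resolvent_sum_mem.
  by apply/LZ/iter_mem.
apply: le_trans (ler_norm_sum _ _ _) _.
apply: (@le_trans _ _ (\sum_(k < N) lam ^+ k * B F F)).
  apply: ler_sum => k _; rewrite normrM (ger0_norm (exprn_ge0 _ lam0)).
  apply: ler_wpM2l; first exact: exprn_ge0.
  apply: form_norm_le => //; [exact: iter_mem|exact: iter_form_le].
rewrite -mulr_suml; apply: ler_wpM2r; first exact: B_ge0.
rewrite -(ler_pM2l (_ : 0 < 1 - lam)) ?subr_gt0// divff ?gt_eqF ?subr_gt0//.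
have := subrX1 lam N; have := exprn_ge0 N lam0; nra.
Qed.

Lemma form_J_resolvent_sum_le N p : L p -> B p p <= B F F ->
  `|B p (J (resolvent_sum lam P F N))| <= (1 - lam)^-1 * B F F.
Proof.
move=> Lp pF; rewrite -BJl//; last exact: resolvent_sum_mem.
by apply: form_resolvent_sum_le; [exact: LJ|rewrite BJ].
Qed.

Lemma form_JP_le x : L x -> `|B x (J (P x))| <= B x x.
Proof.
move=> Lx; apply: form_norm_le => //; first by apply/LJ/LP.
by rewrite BJ ?P_le//; apply: LP.
Qed.

End one_operator.

(* Both resolvent sums are compared at the point whose [J]-invariant part is
   that of [X] and whose [J]-anti-invariant part is that of [Y]: the functional
   [x |-> 2 B F x - saddle_form x x] is concave in the former and convex in the
   latter. *)
Lemma resolvent_sum_le (P P' : V -> V) (F : V) (lam : R) (N : nat) :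
  reversible_contraction P -> reversible_contraction P' ->
  (forall x, L x -> B x (J (P x)) <= B x (J (P' x))) ->
  L F -> (forall x, L x -> B F (J x) = B F x) -> 0 <= lam < 1 ->
  B F (resolvent_sum lam P F N) <= B F (resolvent_sum lam P' F N)
    + lam ^+ N * (8%:R * ((1 - lam)^-1 * B F F)).
Proof.
move=> PP PP' PP'le LF JF lam01; have /andP[lam0 lam1] := lam01.
set X := resolvent_sum _ P _ _; set Y := resolvent_sum _ P' _ _.
have LX : L X by exact: resolvent_sum_mem.
have LY : L Y by exact: resolvent_sum_mem.
(* Projections onto the [J]-invariant and the [J]-anti-invariant vectors. *)
pose inv x := 2^-1 *: (x + J x); pose ant x := 2^-1 *: (x - J x).
have Linv x : L x -> L (inv x) by move=> Lx; apply/LZ/LD => //; exact: LJ.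
have Lant x : L x -> L (ant x) by move=> Lx; apply/LZ/LB => //; exact: LJ.
have Jinv x : J (inv x) = inv x by rewrite /inv JZ JD JK addrC.
have Jant x : J (ant x) = - ant x by rewrite /ant JZ JD JN JK -scalerN opprB addrC.
have invD x : x = inv x + ant x.
  rewrite /inv /ant -scalerDr addrACA subrr addr0 -mulr2n -(scaler_nat 2 x) scalerA.
  by rewrite mulVf ?scale1r// pnatr_eq0.
(* The comparison point [inv X + ant Y] is reached from [X] by the anti-invariant step [d] and from
   [Y] by the invariant step [d']. *)
pose d := ant Y - ant X; pose d' := inv X - inv Y.
have Jd : J d = - d by rewrite /d JD JN !Jant -opprD.
have Jd' : J d' = d' by rewrite /d' JD JN !Jinv.
have Ld : L d by apply: LB; exact: Lant.
have Ld' : L d' by apply: LB; exact: Linv.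
have WE : X + d = Y + d'.
  rewrite {1}(invD X) {1}(invD Y) /d /d' [inv Y + _]addrC [RHS]addrACA subrr.
  by rewrite addr0 [LHS]addrC -addrA [- ant X + _]addrC addrK addrC [inv X + _]addrC.
pose W := X + d; have LW : L W by exact: LD.
(* Up to remainders of order [lam ^+ N], the argument is the chain
   [G P X <= G P W <= G P' W <= G P' Y], whose ends are [B F X] and [B F Y]. *)
pose G Q x := 2 * B F x - saddle_form lam Q x x.
have GD Q x z : reversible_contraction Q -> L x -> L z ->
    G Q (x + z) = G Q x + 2 * (B F z - saddle_form lam Q x z) - saddle_form lam Q z z.
  move=> QQ Lx Lz; have Lxz : L (x + z) by exact: LD.
  rewrite /G saddle_formDl// (saddle_formC lam QQ Lx Lxz) (saddle_formC lam QQ Lz Lxz).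
  by rewrite !saddle_formDl// BDr// (saddle_formC lam QQ Lz Lx); ring.
have GX : G P X = B F X + lam ^+ N * B (iter N P F) (J X).
  by rewrite /G saddle_form_resolvent//; ring.
have GY : G P' Y = B F Y + lam ^+ N * B (iter N P' F) (J Y).
  by rewrite /G saddle_form_resolvent//; ring.
have GW : G P W <= G P' W.
  rewrite /G /saddle_form; have := PP'le W LW; nra.
have GWX : G P W = G P X + 2 * (lam ^+ N * B (iter N P F) (J d)) - saddle_form lam P d d.
  by rewrite GD// saddle_form_resolvent//; ring.
have GWY : G P' W = G P' Y + 2 * (lam ^+ N * B (iter N P' F) (J d'))
    - saddle_form lam P' d' d'.
  by rewrite /W WE GD// saddle_form_resolvent//; ring.
(* On anti-invariant vectors the leading term is [- B d d], on invariant ones [+ B d' d']; as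
   [lam < 1], the contraction term cannot change either sign. *)
have sd : saddle_form lam P d d <= 0.
  rewrite /saddle_form Jd BNr//.
  by have := form_JP_le PP Ld; rewrite ler_norml => /andP[? ?]; nra.
have sd' : 0 <= saddle_form lam P' d' d'.
  rewrite /saddle_form Jd'.
  by have := form_JP_le PP' Ld'; rewrite ler_norml => /andP[? ?]; nra.
set p := iter N P F; set p' := iter N P' F.
have Lp : L p by exact: iter_mem.
have Lp' : L p' by exact: iter_mem.
set c := (1 - lam)^-1 * B F F.
have pp := iter_form_le PP LF N; have pp' := iter_form_le PP' LF N.
(* The remainders are rewritten as pairings with [X], [J X], [Y], [J Y], which are bounded uniformly
   in [N]. *)
have Bd q : L q -> 2 * B q d = B q Y - B q (J Y) - B q X + B q (J X).
  move=> Lq; rewrite /d BDr//; try exact: LN (Lant _ _); try exact: Lant.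
  rewrite BNr//; last exact: Lant.
  rewrite !BZr//; try by apply: LB => //; exact: LJ.
  rewrite !BDr// ?BNr//; try exact: LJ; try by apply: LN; exact: LJ.
  by field.
have Bd' q : L q -> 2 * B q d' = B q X + B q (J X) - B q Y - B q (J Y).
  move=> Lq; rewrite /d' BDr//; try exact: LN (Linv _ _); try exact: Linv.
  rewrite BNr//; last exact: Linv.
  rewrite !BZr//; try by apply: LD => //; exact: LJ.
  rewrite !BDr// ?BNr//; try exact: LJ; try by apply: LN; exact: LJ.
  by field.
have key : B F X + lam ^+ N * (B p (J X) - 2 * B p d)
    <= B F Y + lam ^+ N * (B p' (J Y) + 2 * B p' d').
  move: GWX GWY; rewrite Jd Jd' BNr// -/p -/p'; lra.
move: key; rewrite Bd// Bd'//.
have := form_resolvent_sum_le PP LF lam01 N Lp pp.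
have := form_resolvent_sum_le PP LF lam01 N Lp' pp'.
have := form_resolvent_sum_le PP' LF lam01 N Lp pp.
have := form_resolvent_sum_le PP' LF lam01 N Lp' pp'.
have := form_J_resolvent_sum_le PP LF lam01 N Lp' pp'.
have := form_J_resolvent_sum_le PP' LF lam01 N Lp pp.
rewrite -/X -/Y -/c !ler_norml.
move=> /andP[? ?] /andP[? ?] /andP[? ?] /andP[? ?] /andP[? ?] /andP[? ?].
have := exprn_ge0 N lam0; set l := lam ^+ N => l0 h.
(* [B p (J X)] and [B p' (J Y)] cancel. Six pairings remain, each at most [c] in absolute value, so
   [8 * c] suffices. *)
suff : l * (B p' (J Y) + (B p' X + B p' (J X) - B p' Y - B p' (J Y)))
   - l * (B p (J X) - (B p Y - B p (J Y) - B p X + B p (J X))) <= l * (8%:R * c) by lra.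
by rewrite -mulrBr; apply: ler_wpM2l => //; lra.
Qed.

End saddle_point.

(** * Integration against mixtures, densities and invariant measures *)

Section mixture.
Local Open Scope ereal_scope.
Import HBNNSimple.

(** Proved for simple functions level set by level set, then by monotone convergence. Weighted Dirac
    masses, Dirac masses along a map and a Markov kernel are the three choices of [k] made below. *)
Lemma ge0_integral_mixture (d d' : measure_display) (X : measurableType d)
    (Y : measurableType d') (R : realType) (l : {measure set X -> \bar R})
    (k : X -> {measure set Y -> \bar R}) (m : {measure set Y -> \bar R})
    (f : Y -> \bar R) :
  (forall U, measurable U -> measurable_fun [set: X] (fun x => k x U : \bar R)) ->
  (forall U, measurable U -> m U = \int[l]_x k x U) ->
  (forall y, 0 <= f y) -> measurable_fun [set: Y] f ->
  \int[m]_y f y = \int[l]_x \int[k x]_y f y.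
Proof.
move=> mk mE f0 mf.
pose f_ := nnsfun_approx measurableT mf.
have simple (h : {nnsfun Y >-> R}) :
    \int[m]_y (h y)%:E = \int[l]_x \int[k x]_y (h y)%:E.
  have decomp (p : {measure set Y -> \bar R}) :
      \int[p]_y (h y)%:E = \sum_(r \in range h) r%:E * p (h @^-1` [set r]).
    under eq_integral do rewrite fimfunE -fsumEFin//.
    rewrite ge0_integral_fsum//; last 2 first.
      - by move=> r; exact/measurable_EFinP/measurableT_comp.
      - by move=> r y _; rewrite EFinM nnfun_muleindic_ge0.
    apply: eq_fsbigr => r _.
    rewrite (integralZl_indic _ (fun r => h @^-1` [set r]))//; last first.
      by move=> r0; rewrite preimage_nnfun0.
    by rewrite integral_indic// setIT.
  rewrite decomp; under [RHS]eq_integral do rewrite decomp.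
  rewrite ge0_integral_fsum//; last 2 first.
    - by move=> r; apply: measurable_funeM; exact: mk.
    - by move=> r x _; have := mulemu_ge0 (fun r => h @^-1` [set r]); apply;
        exact: preimage_nnfun0.
  apply: eq_fsbigr => r _; rewrite mE//.
  (* For [r < 0] the level set of the nonnegative [h] is empty and both sides vanish. *)
  have [r0|r0] := leP 0%R r; first by rewrite ge0_integralZl//; exact: mk.
  rewrite !integral0_eq ?mule0// => x _; last by rewrite preimage_nnfun0// measure0.
  by rewrite preimage_nnfun0// measure0 mule0.
have fE (p : {measure set Y -> \bar R}) :
    \int[p]_y f y = limn (fun n => \int[p]_y (f_ n y)%:E).
  rewrite -monotone_convergence//; last 3 first.
    - by move=> n; exact/measurable_EFinP.
    - by move=> n y _; rewrite lee_fin.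
    - by move=> y _ a b ab; rewrite lee_fin; exact/lefP/nd_nnsfun_approx.
  by apply: eq_integral => y _; apply/esym/cvg_lim => //=; exact: cvg_nnsfun_approx.
rewrite fE; under eq_fun do rewrite simple.
rewrite -monotone_convergence//; last 3 first.
- move=> n; apply: measurable_fun_integral_kernel => //.
  + by move=> y; rewrite lee_fin.
  + exact/measurable_EFinP.
- by move=> n x _; apply: integral_ge0 => y _; rewrite lee_fin.
- move=> x _ a b ab; apply: ge0_le_integral => //.
  + by move=> y _; rewrite lee_fin.
  + exact/measurable_EFinP.
  + exact/measurable_EFinP.
  + by move=> y _; rewrite lee_fin; exact/lefP/nd_nnsfun_approx.
by apply: eq_integral => x _; rewrite fE.
Qed.

(** A measure with density [g] is the mixture of the masses [g x] placed at [x]. *)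
Lemma ge0_integral_density (d : measure_display) (X : measurableType d)
    (R : realType) (l m : {measure set X -> \bar R}) (g : X -> R) (f : X -> \bar R) :
  measurable_fun [set: X] g -> (forall x, (0 <= g x)%R) ->
  (forall U, measurable U -> m U = \int[l]_(x in U) (g x)%:E) ->
  (forall x, 0 <= f x) -> measurable_fun [set: X] f ->
  \int[m]_x f x = \int[l]_x ((g x)%:E * f x).
Proof.
move=> mg g0 mE f0 mf.
pose k x : {measure set X -> \bar R} := mscale (NngNum (g0 x)) \d_x.
have kE x U : k x U = (g x * \1_U x)%:E by rewrite /= /mscale/= diracE EFinM.
rewrite (@ge0_integral_mixture _ _ _ _ _ l k)//.
- apply: eq_integral => x _.
  by rewrite ge0_integral_mscale// integral_dirac// diracT mul1e.
- move=> U mU; under eq_fun do rewrite kE.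
  by apply/measurable_EFinP/measurable_funM.
- move=> U mU; rewrite mE// integral_mkcond; apply: eq_integral => x _.
  rewrite kE /patch indicE; case: ifPn => _; by rewrite ?mulr1 ?mulr0.
Qed.

(** An invariant measure is the mixture of Dirac masses at [T x], which settles nonnegative
    integrands. The general case splits the restriction to [D] into positive and negative parts,
    without integrability. *)
Lemma integral_comp_preserving (d : measure_display) (X : measurableType d)
    (R : realType) (m : {measure set X -> \bar R}) (T : X -> X) (D : set X)
    (f : X -> \bar R) :
  measurable_fun [set: X] T ->
  (forall U, measurable U -> m (T @^-1` U) = m U) ->
  measurable D -> measurable_fun [set: X] f ->
  \int[m]_(x in T @^-1` D) f (T x) = \int[m]_(x in D) f x.
Proof.
move=> mT mE mD mf.
have ge0 (h : X -> \bar R) : (forall x, 0 <= h x) -> measurable_fun setT h ->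
    \int[m]_x h (T x) = \int[m]_x h x.
  move=> h0 mh; pose k x : {measure set X -> \bar R} := \d_(T x).
  have kE x U : k x U = (\1_U (T x))%:E by [].
  rewrite (@ge0_integral_mixture _ _ _ _ _ m k _ h)//.
  - by apply: eq_integral => x _; rewrite integral_dirac// diracT mul1e.
  - move=> U mU; under eq_fun do rewrite kE.
    by apply/measurable_EFinP; apply: measurableT_comp mT.
  - move=> U mU; rewrite -mE// -(setIT (T @^-1` U)) -integral_indic//.
    by rewrite -[X in measurable X]setTI; exact: mT.
rewrite integral_mkcond [RHS]integral_mkcond.
have mfD : measurable_fun setT (f \_ D).
  by apply/(measurable_restrictT _ _).1 => //; exact: measurable_funTS.
rewrite integralE [RHS]integralE -(ge0 (f \_ D)^\+)//; last first.
  exact: measurable_funepos.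
rewrite -(ge0 (f \_ D)^\-)//; last exact: measurable_funeneg.
congr (_ - _); apply: eq_integral => x _;
  by rewrite ?funeposE ?funenegE /patch.
Qed.

End mixture.

(** * Square-integrable functions and their semi-inner product *)

Section square_integrable.
Context (d : measure_display) (E : measurableType d) (R : realType).
Variable m : {measure set E -> \bar R}.
Implicit Types f g h : E -> R.

Lemma L2_integrableM f g : L2 m f -> L2 m g ->
  m.-integrable [set: E] (EFin \o (fun x => f x * g x)).
Proof.
move=> [mf f2] [mg g2].
apply: le_integrable (integrableD measurableT f2 g2) => //.
  by apply/measurable_EFinP; exact: measurable_funM.
move=> x _; rewrite -EFinD !abse_EFin lee_fin [leRHS]ger0_norm ?addr_ge0 ?sqr_ge0//.
by rewrite ler_norml; nra.
Qed.

Lemma L2_intro f c : measurable_fun [set: E] f -> (0 <= c < +oo)%E ->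
  (\int[m]_x ((f x) ^+ 2)%:E <= c)%E -> L2 m f.
Proof.
move=> mf /andP[_ cy] fc; split=> //; apply/integrableP; split.
  by apply/measurable_EFinP; exact: measurable_funX.
apply: le_lt_trans cy; apply: le_trans fc.
rewrite le_eqVlt; apply/orP; left; apply/eqP; apply: eq_integral => x _.
by rewrite gee0_abs// lee_fin sqr_ge0.
Qed.

Lemma L2_lty f : L2 m f -> (0 <= \int[m]_x ((f x) ^+ 2)%:E < +oo)%E.
Proof.
move=> [_ fi]; rewrite (integrable_lty _ fi)// andbT.
by apply: integral_ge0 => x _; rewrite lee_fin sqr_ge0.
Qed.

Lemma L2_le f g : measurable_fun [set: E] f -> L2 m g ->
  (forall x, `|f x| <= `|g x|) -> L2 m f.
Proof.
move=> mf Lg fg; apply: (L2_intro mf (L2_lty Lg)).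
apply: ge0_le_integral => //.
- by move=> x _; rewrite lee_fin sqr_ge0.
- by apply/measurable_EFinP; exact: measurable_funX.
- by apply/measurable_EFinP; apply: measurable_funX; case: Lg.
- move=> x _; rewrite lee_fin -[leLHS]real_normK ?num_real//.
  by rewrite -[leRHS]real_normK ?num_real// lerXn2r ?nnegrE.
Qed.

Lemma L2D f g : L2 m f -> L2 m g -> L2 m (f + g).
Proof.
move=> Lf Lg; have [mf f2] := Lf; have [mg g2] := Lg.
split; first exact: measurable_funD.
have fg := L2_integrableM Lf Lg.
apply: eq_integrable (integrableD measurableT
  (integrableD measurableT f2 g2) (integrableZl measurableT 2 fg)) => // x _.
by rewrite /= -EFinM -!EFinD; congr EFin; rewrite addrfctE; ring.
Qed.

Lemma L2Z (a : R) f : L2 m f -> L2 m (a *: f).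
Proof.
move=> [mf f2]; split; first exact: measurable_funM.
apply: eq_integrable (integrableZl measurableT (a ^+ 2) f2) => // x _.
by rewrite /= -EFinM; congr EFin; rewrite scalrfctE /GRing.scale/=; ring.
Qed.

Lemma L2_0 : L2 m 0.
Proof.
split; first exact: measurable_cst.
by apply: eq_integrable (integrable0 m _) => // x _; rewrite /= expr0n.
Qed.

Lemma innerC f g : inner m f g = inner m g f.
Proof. by congr fine; apply: eq_integral => x _; rewrite mulrC. Qed.

Lemma innerDl f g h : L2 m f -> L2 m g -> L2 m h ->
  inner m (f + g) h = inner m f h + inner m g h.
Proof.
move=> Lf Lg Lh; rewrite -[RHS]RintegralD//; try exact: L2_integrableM.
by apply: eq_Rintegral => x _; rewrite addrfctE mulrDl.
Qed.

Lemma innerZl (a : R) f h : L2 m f -> L2 m h ->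
  inner m (a *: f) h = a * inner m f h.
Proof.
move=> Lf Lh; rewrite -[RHS]RintegralZl//; try exact: L2_integrableM.
by apply: eq_Rintegral => x _; rewrite scalrfctE /GRing.scale/= mulrA.
Qed.

Lemma inner_ge0 f : 0 <= inner m f f.
Proof. by apply: Rintegral_ge0 => x _; rewrite -expr2 sqr_ge0. Qed.

Lemma inner_ae_eql f g h : L2 m f -> L2 m g -> L2 m h ->
  {ae m, forall x, f x = g x} -> inner m f h = inner m g h.
Proof.
move=> Lf Lg Lh fg; congr fine; apply: ae_eq_integral => //.
- exact: measurable_int (L2_integrableM Lf Lh).
- exact: measurable_int (L2_integrableM Lg Lh).
- by apply: filterS fg => x /= -> _.
Qed.

Lemma EFin_inner f g : L2 m f -> L2 m g ->
  (inner m f g)%:E = (\int[m]_x (f x * g x)%:E)%E.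
Proof.
by move=> Lf Lg; rewrite fineK//; apply: integrable_fin_num => //; exact: L2_integrableM.
Qed.

Lemma inner_le f g : L2 m f -> L2 m g ->
  (\int[m]_x ((f x) ^+ 2)%:E <= \int[m]_x ((g x) ^+ 2)%:E)%E ->
  inner m f f <= inner m g g.
Proof. by move=> Lf Lg; rewrite -lee_fin !EFin_inner. Qed.

Section preserving.
Variable xi : E -> E.
Hypothesis mxi : measurable_fun [set: E] xi.
Hypothesis xi_inv : forall A, measurable A -> m (xi @^-1` A) = m A.

Lemma L2_comp f : L2 m f -> L2 m (f \o xi).
Proof.
move=> Lf; have [mf _] := Lf.
apply: L2_intro (L2_lty Lf) _; first exact: measurableT_comp.
rewrite (@integral_comp_preserving _ _ _ m xi setT (fun y => (f y ^+ 2)%:E))//.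
by apply/measurable_EFinP; exact: measurable_funX.
Qed.

Lemma inner_comp f g : L2 m f -> L2 m g ->
  inner m (f \o xi) (g \o xi) = inner m f g.
Proof.
move=> [mf _] [mg _]; congr fine.
apply: (@integral_comp_preserving _ _ _ m xi setT (fun y => (f y * g y)%:E)) => //.
by apply/measurable_EFinP; exact: measurable_funM.
Qed.

End preserving.

End square_integrable.

Lemma L2_cst (d : measure_display) (E : measurableType d) (R : realType)
  (m : {measure set E -> \bar R}) (c : R) : (m [set: E] < +oo)%E -> L2 m (cst c).
Proof.
move=> my; apply: (@L2_intro _ _ _ _ _ ((c ^+ 2)%:E * m setT)%E) => //.
  by rewrite lte_mul_pinfty// ?andbT ?mule_ge0// lee_fin sqr_ge0.
by rewrite -(integral_cst m measurableT).
Qed.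

(** Jensen's inequality for the square, from nonnegativity of the variance; an infinite right-hand
    side is trivial. The extended-real form lets it apply to [K x] for every [x], even where [f] has
    infinite second moment. *)
Lemma sqr_mean_le (d : measure_display) (E : measurableType d) (R : realType)
    (m : {measure set E -> \bar R}) (f : E -> R) :
  m [set: E] = 1%E -> measurable_fun [set: E] f ->
  ((mean m f ^+ 2)%:E <= \int[m]_x ((f x) ^+ 2)%:E)%E.
Proof.
move=> m1 mf; have := leey (\int[m]_x ((f x) ^+ 2)%:E)%E.
rewrite le_eqVlt => /predU1P[->|fy]; first exact: leey.
have Lf : L2 m f.
  apply: L2_intro (lexx _) => //; rewrite fy andbT.
  by apply: integral_ge0 => x _; rewrite lee_fin sqr_ge0.
have L1 : L2 m (cst 1) by apply: L2_cst; rewrite m1 ltry.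
have LcN := L2Z (- mean m f) L1.
have fE : inner m f (cst 1) = mean m f.
  by congr fine; apply: eq_integral => x _; rewrite mulr1.
have oneE : inner m (cst 1) (cst 1) = 1.
  rewrite /inner -[RHS]/(fine 1%:E) -m1 -[m setT]mul1e -integral_cst//.
  by congr fine; apply: eq_integral => x _; rewrite mulr1.
have := inner_ge0 m (f + - mean m f *: cst 1).
rewrite innerDl//; last exact: L2D.
rewrite innerZl//; last exact: L2D.
rewrite ![inner m _ (f + _)]innerC !innerDl// !innerZl//.
rewrite [inner m (cst 1) f]innerC fE oneE => h.
have -> : (\int[m]_x ((f x) ^+ 2)%:E = (inner m f f)%:E)%E by rewrite EFin_inner.
by rewrite lee_fin; nra.
Qed.

(** * A reversible Markov kernel is a contraction of [L2] *)

Section kernel_operator.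
Context (d : measure_display) (E : measurableType d) (R : realType).
Variables (mu : probability E R) (K : R.-pker E ~> E).

Lemma measurable_kop f : measurable_fun [set: E] f -> measurable_fun [set: E] (kop K f).
Proof.
move=> mf; apply: (measurableT_comp (@fine_measurable _ _ measurableT)).
under eq_fun do rewrite integralE.
apply: emeasurable_funB; apply: measurable_fun_integral_kernel => //.
- by move=> U mU; exact: measurable_kernel.
- by apply: measurable_funepos; exact/measurable_EFinP.
- by move=> U mU; exact: measurable_kernel.
- by apply: measurable_funeneg; exact/measurable_EFinP.
Qed.

Variable xi : E -> E.
Hypothesis mxi : measurable_fun [set: E] xi.
Hypothesis xiK : involutive xi.
Hypothesis xi_inv : forall A, measurable A -> mu (xi @^-1` A) = mu A.
Hypothesis Krev : reversible mu xi (kop K).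

(* Reversibility of [K], tested against the constant function 1. *)
Lemma reversible_invariant U : measurable U -> mu U = (\int[mu]_x K x U)%E.
Proof.
move=> mU.
have kop1 : kop K (cst 1) = cst 1.
  apply/funext => x; apply: (congr1 fine (_ : _ = 1%E)).
  by rewrite (integral_cst (K x) measurableT 1%E) prob_kernel mule1.
have muy : (mu [set: E] < +oo)%E by rewrite probability_setT ltry.
have L1 : L2 mu (cst 1) := L2_cst 1 muy.
have LU : L2 mu (\1_U : E -> R).
  apply: L2_le L1 _ => // x; rewrite indicE /= normr1.
  by case: (x \in U); rewrite ?normr0 ?normr1 ?ler01.
have KU : kop K (\1_U : E -> R) = fun x => fine (K x U).
  by apply/funext => x; rewrite /kop integral_indic// setIT.
have mKU : measurable_fun [set: E] (kop K (\1_U : E -> R)) by exact: measurable_kop.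
have Kfin x : K x U \is a fin_num.
  rewrite ge0_fin_numE//; apply: (@le_lt_trans _ _ (K x setT)).
    by apply: le_measure; rewrite ?inE.
  by rewrite prob_kernel ltry.
(* The test function is [\1_U \o xi], so that the inner [Q] of [Q P Q] restores [\1_U]; the outer
   composition with [xi] is absorbed by invariance of [mu]. *)
have := Krev L1 (L2_comp mxi xi_inv LU).
rewrite kop1 /Qop.
have -> : (\1_U \o xi) \o xi = \1_U :> (E -> R).
  by apply/funext => x /=; rewrite xiK.
have LKU : L2 mu (kop K (\1_U : E -> R)).
  apply: L2_le L1 _ => // x; rewrite KU /= normr1 ger0_norm; last exact: fine_ge0.
  rewrite -lee_fin fineK// -(prob_kernel (s := K) x).
  by apply: le_measure; rewrite ?inE.
rewrite -[X in inner mu X _]/(cst 1 \o xi) inner_comp//.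
rewrite -[X in _ = inner mu X _ -> _]/(cst 1 \o xi) inner_comp//.
move=> e; have : (inner mu (cst 1) \1_U)%:E = (inner mu (cst 1) (kop K \1_U))%:E.
  by rewrite e.
rewrite !EFin_inner// => e'.
have -> : mu U = (\int[mu]_x (cst 1 x * \1_U x)%:E)%E.
  by under eq_integral do rewrite mul1r; rewrite integral_indic// setIT.
by rewrite e'; apply: eq_integral => x _; rewrite mul1r KU fineK.
Qed.

(** Jensen's inequality for each [K x], integrated against [mu], which [K] leaves invariant. *)
Lemma kop_le f : measurable_fun [set: E] f ->
  (\int[mu]_x ((kop K f x) ^+ 2)%:E <= \int[mu]_x ((f x) ^+ 2)%:E)%E.
Proof.
move=> mf; have mf2 : measurable_fun [set: E] (fun x => ((f x) ^+ 2)%:E).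
  by apply/measurable_EFinP; exact: measurable_funX.
have mK U : measurable U -> measurable_fun [set: E] (fun x => K x U : \bar R).
  by move=> mU; exact: measurable_kernel.
have f20 y : (0 <= ((f y) ^+ 2)%:E :> \bar R)%E by rewrite lee_fin sqr_ge0.
rewrite (@ge0_integral_mixture _ _ _ _ _ mu K mu (fun x => ((f x) ^+ 2)%:E))//.
  apply: ge0_le_integral => //.
  - by move=> x _; rewrite lee_fin sqr_ge0.
  - by apply/measurable_EFinP; apply: measurable_funX; exact: measurable_kop.
  - exact: measurable_fun_integral_kernel.
  - by move=> x _; apply: sqr_mean_le => //; rewrite prob_kernel.
exact: reversible_invariant.
Qed.

Lemma kop_L2 f : L2 mu f -> L2 mu (kop K f).
Proof.
move=> Lf; have [mf _] := Lf.
exact: L2_intro (measurable_kop mf) (L2_lty Lf) (kop_le mf).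
Qed.

Lemma inner_kop_le f : L2 mu f -> inner mu (kop K f) (kop K f) <= inner mu f f.
Proof.
move=> Lf; have [mf _] := Lf.
by apply: inner_le => //; [exact: kop_L2|exact: kop_le].
Qed.

End kernel_operator.

(** * The Metropolis-type operator with an abstract acceptance weight *)

Section involutive_metropolis.
Context (d : measure_display) (E : measurableType d) (R : realType).
Variables (mu : {measure set E -> \bar R}) (xi psi : E -> E).
Hypothesis mxi : measurable_fun [set: E] xi.
Hypothesis xiK : involutive xi.
Hypothesis xi_inv : forall A, measurable A -> mu (xi @^-1` A) = mu A.
Hypothesis mpsi : measurable_fun [set: E] psi.
Hypothesis tauK : forall x, xi (psi (xi (psi x))) = x.

(** Detailed balance: the measure [w . mu] is invariant under the involution [xi \o psi]. *)
Definition balanced (w : E -> R) : Prop :=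
  [/\ measurable_fun [set: E] w, forall z, 0 <= w z <= 1 &
    forall h : E -> \bar R, (forall z, (0 <= h z)%E) -> measurable_fun [set: E] h ->
      (\int[mu]_z ((w z)%:E * h (xi (psi z))) = \int[mu]_z ((w z)%:E * h z))%E].

Lemma balanced_integral (w h : E -> R) : balanced w -> measurable_fun [set: E] h ->
  (\int[mu]_z (w z * h (xi (psi z)))%:E = \int[mu]_z (w z * h z)%:E)%E.
Proof.
move=> [mw w01 wE] mh.
have w0 z : 0 <= w z by have /andP[] := w01 z.
have mEh : measurable_fun [set: E] (fun z => (h z)%:E) by exact/measurable_EFinP.
rewrite integralE [RHS]integralE.
have pos (g : E -> R) z :
    ((fun z => (w z * g z)%:E)^\+ z = (w z)%:E * (fun z => (g z)%:E)^\+ z)%E.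
  by rewrite !funeposE -!EFin_max -EFinM maxr_pMr// mulr0.
have neg (g : E -> R) z :
    ((fun z => (w z * g z)%:E)^\- z = (w z)%:E * (fun z => (g z)%:E)^\- z)%E.
  by rewrite !funenegE -!EFinN -!EFin_max -EFinM maxr_pMr// mulr0 mulrN.
congr (_ - _)%E.
- transitivity (\int[mu]_z ((w z)%:E * (fun z => (h z)%:E)^\+ (xi (psi z))))%E.
    by apply: eq_integral => z _; rewrite (pos (fun z => h (xi (psi z)))) !funeposE.
  rewrite (wE (fun z => (h z)%:E)^\+%E)//; last exact: measurable_funepos.
  by apply: eq_integral => z _; rewrite pos.
- transitivity (\int[mu]_z ((w z)%:E * (fun z => (h z)%:E)^\- (xi (psi z))))%E.
    by apply: eq_integral => z _; rewrite (neg (fun z => h (xi (psi z)))) !funenegE.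
  rewrite (wE (fun z => (h z)%:E)^\-%E)//; last exact: measurable_funeneg.
  by apply: eq_integral => z _; rewrite neg.
Qed.

Section one_weight.
Variables (w : E -> R).
Hypothesis bw : balanced w.

Let mw : measurable_fun [set: E] w. Proof. by case: bw. Qed.
Let w0 z : 0 <= w z. Proof. by case: bw => _ /(_ z)/andP[]. Qed.
Let w1 z : w z <= 1. Proof. by case: bw => _ /(_ z)/andP[]. Qed.

Definition accepted (x : E -> R) (z : E) : R := w z * x (psi z).
Definition rejected (x : E -> R) (z : E) : R := (1 - w z) * x (xi z).

(** With [idfun] as acceptance function the weight [w] itself is the parameter; [P2op phi xi psi r]
    is the case [w = phi \o r] by conversion. *)
Lemma P2opE x : P2op idfun xi psi w x = accepted x + rejected x.
Proof. by []. Qed.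

Let mx_psi (x : E -> R) : measurable_fun [set: E] x ->
  measurable_fun [set: E] (fun z => x (psi z)).
Proof. by move=> mx; exact: measurableT_comp. Qed.

Let mx_xi (x : E -> R) : measurable_fun [set: E] x ->
  measurable_fun [set: E] (fun z => x (xi z)).
Proof. by move=> mx; exact: measurableT_comp. Qed.

(** Since [psi = xi \o (xi \o psi)], balance trades [psi] for [xi] under the weight [w]. *)
Lemma balanced_integral_psi (h : E -> R) : measurable_fun [set: E] h ->
  (\int[mu]_z (w z * h (psi z))%:E = \int[mu]_z (w z * h (xi z))%:E)%E.
Proof.
move=> mh; rewrite -(balanced_integral bw (mx_xi mh)).
by apply: eq_integral => z _; rewrite xiK.
Qed.

Lemma L2_weighted (v u : E -> R) : measurable_fun [set: E] u ->
  (forall z, `|u z| <= 1) -> L2 mu v -> L2 mu (fun z => u z * v z).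
Proof.
move=> mu' u1 Lv; have [mv _] := Lv; apply: L2_le Lv _.
  exact: measurable_funM.
by move=> z; rewrite normrM; have := normr_ge0 (v z); have := u1 z; nra.
Qed.

Lemma L2_rejected x : L2 mu x -> L2 mu (rejected x).
Proof.
move=> Lx; apply: (@L2_weighted (x \o xi)); last exact: L2_comp.
  exact: measurable_funB.
by move=> z; rewrite ger0_norm ?subr_ge0// lerBlDr lerDl.
Qed.

(** [psi] need not preserve [mu], so [x \o psi] is controlled only under the weight: balance
    replaces it by [x \o xi], and [xi] preserves [mu]. *)
Lemma integral_accepted_le x : L2 mu x ->
  (\int[mu]_z (w z * (x (psi z)) ^+ 2)%:E <= \int[mu]_z ((x z) ^+ 2)%:E)%E.
Proof.
move=> Lx; have [mx _] := Lx.
have mx2 : measurable_fun [set: E] (fun z => x z ^+ 2) by exact: measurable_funX.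
rewrite (balanced_integral_psi mx2)//.
rewrite -(@integral_comp_preserving _ _ _ mu xi setT (fun z => (x z ^+ 2)%:E))//; last first.
  exact/measurable_EFinP.
rewrite preimage_setT; apply: ge0_le_integral => //.
- by move=> z _; rewrite lee_fin mulr_ge0// sqr_ge0.
- by apply/measurable_EFinP; apply: measurable_funM => //; exact: (mx_xi mx2).
- by apply/measurable_EFinP; exact: (mx_xi mx2).
- by move=> z _; rewrite lee_fin ler_piMl// sqr_ge0.
Qed.

Lemma L2_accepted x : L2 mu x -> L2 mu (accepted x).
Proof.
move=> Lx; have [mx _] := Lx.
have ma : measurable_fun [set: E] (accepted x).
  by apply: measurable_funM => //; exact: mx_psi.
apply: (L2_intro ma (L2_lty Lx)).
apply: le_trans (integral_accepted_le Lx); apply: ge0_le_integral => //.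
- by move=> z _; rewrite lee_fin sqr_ge0.
- by apply/measurable_EFinP; exact: measurable_funX.
- apply/measurable_EFinP; apply: measurable_funM => //.
  by apply: measurable_funX; exact: mx_psi.
- move=> z _; rewrite lee_fin /accepted exprMn; apply: ler_wpM2r; first exact: sqr_ge0.
  by rewrite expr2 ler_piMl.
Qed.

Lemma L2_P2op x : L2 mu x -> L2 mu (P2op idfun xi psi w x).
Proof. by move=> Lx; apply: L2D; [exact: L2_accepted|exact: L2_rejected]. Qed.

Lemma inner_P2op x y : L2 mu x -> L2 mu y ->
  inner mu (P2op idfun xi psi w x) y = inner mu (accepted x) y + inner mu (rejected x) y.
Proof.
by move=> Lx Ly; rewrite P2opE innerDl//; [exact: L2_accepted|exact: L2_rejected].
Qed.

(** Convexity of the square bounds the integrand by [w (x \o psi)^2 + (1 - w) (x \o xi)^2]. Once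
    balance has turned [psi] into [xi], the weights add up to 1. *)
Lemma inner_P2op_le x : L2 mu x ->
  inner mu (P2op idfun xi psi w x) (P2op idfun xi psi w x) <= inner mu x x.
Proof.
move=> Lx; have [mx _] := Lx; apply: inner_le => //; first exact: L2_P2op.
have mx2 : measurable_fun [set: E] (fun z => x z ^+ 2) by exact: measurable_funX.
pose a z := w z * (x (psi z)) ^+ 2; pose b z := (1 - w z) * (x (xi z)) ^+ 2.
have ma : measurable_fun [set: E] a.
  by apply: measurable_funM => //; exact: (mx_psi mx2).
have mb : measurable_fun [set: E] b.
  apply: measurable_funM; first exact: measurable_funB.
  exact: (mx_xi mx2).
have a0 z : 0 <= a z by rewrite mulr_ge0// sqr_ge0.
have b0 z : 0 <= b z by rewrite mulr_ge0 ?sqr_ge0// subr_ge0.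
apply: (@le_trans _ _ (\int[mu]_z ((a z)%:E + (b z)%:E))%E).
  apply: ge0_le_integral => //.
  - by move=> z _; rewrite lee_fin sqr_ge0.
  - by apply/measurable_EFinP; apply: measurable_funX; case: (L2_P2op Lx).
  - by apply/measurable_EFinP; exact: measurable_funD.
  - move=> z _; rewrite -EFinD lee_fin /P2op /a /b /=.
    have := sqr_ge0 (x (psi z) - x (xi z)); have := w0 z; have := w1 z.
    move: (w z) (x (psi z)) (x (xi z)) => c p q c1 c0 pq; rewrite -subr_ge0.
    have -> : c * p ^+ 2 + (1 - c) * q ^+ 2 - (c * p + (1 - c) * q) ^+ 2
      = c * (1 - c) * (p - q) ^+ 2 by ring.
    by apply: mulr_ge0 => //; apply: mulr_ge0 => //; rewrite subr_ge0.
rewrite ge0_integralD//; last 4 first.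
- by move=> z _; rewrite lee_fin.
- exact/measurable_EFinP.
- by move=> z _; rewrite lee_fin.
- exact/measurable_EFinP.
rewrite (balanced_integral_psi mx2)// -ge0_integralD//; last 4 first.
- by move=> z _; rewrite lee_fin mulr_ge0// sqr_ge0.
- by apply/measurable_EFinP; apply: measurable_funM => //; exact: (mx_xi mx2).
- by move=> z _; rewrite lee_fin.
- exact/measurable_EFinP.
rewrite -(@integral_comp_preserving _ _ _ mu xi setT (fun z => (x z ^+ 2)%:E))//; last first.
  exact/measurable_EFinP.
rewrite preimage_setT le_eqVlt; apply/orP; left; apply/eqP.
by apply: eq_integral => z _; rewrite -EFinD /b; congr EFin; ring.
Qed.

(** After composition with [xi], the rejected parts agree pointwise and the accepted parts differ by
    the change of variable [xi \o psi], which balance allows. *)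
Lemma P2op_reversible : reversible mu xi (P2op idfun xi psi w).
Proof.
move=> x y Lx Ly; have [mx _] := Lx; have [my _] := Ly.
have LQx := L2_comp mxi xi_inv Lx.
have LQy := L2_comp mxi xi_inv Ly.
have LPQy := L2_P2op LQy.
rewrite -[RHS](inner_comp mxi xi_inv)//; last exact: L2_comp.
have -> : Qop xi (P2op idfun xi psi w (Qop xi y)) \o xi = P2op idfun xi psi w (y \o xi).
  by apply/funext => z; rewrite /Qop /= xiK.
rewrite [RHS]innerC inner_P2op// [RHS]inner_P2op//; congr (_ + _); congr fine; last first.
  by apply: eq_integral => z _; rewrite /rejected /= xiK; congr EFin; ring.
(* Composed with [xi \o psi], this function becomes [x (psi z) * y z]. *)
have mh : measurable_fun [set: E] (fun z => x (xi z) * y (xi (psi z))).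
  by apply: measurable_funM; [exact: mx_xi|exact: (mx_psi (mx_xi my))].
transitivity (\int[mu]_z (w z * (x (xi z) * y (xi (psi z))))%:E)%E; last first.
  by apply: eq_integral => z _; rewrite /accepted /=; congr EFin; ring.
rewrite -(balanced_integral bw mh).
by apply: eq_integral => z _; rewrite /accepted /= xiK tauK; congr EFin; ring.
Qed.

Definition jump_sqr (x : E -> R) (z : E) : R := (x (xi z) - x (psi z)) ^+ 2.

(** The Dirichlet form of [Q P2]. Expanding the square, balance gives [w (x \o psi)^2] and
    [w (x \o xi)^2] the same integral, so half the total is [w (x \o xi)^2] minus the cross term. *)
Lemma dirichlet_integrable x : L2 mu x ->
  mu.-integrable [set: E] (EFin \o (fun z => w z * jump_sqr x z)) /\
  inner mu x (Qop xi (P2op idfun xi psi w x))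
    = inner mu x x - 2^-1 * \int[mu]_z (w z * jump_sqr x z).
Proof.
move=> Lx; have [mx _] := Lx.
have mx2 : measurable_fun [set: E] (fun z => x z ^+ 2) by exact: measurable_funX.
pose v := x \o xi.
have Lv : L2 mu v := L2_comp mxi xi_inv Lx.
have Lwv : L2 mu (fun z => w z * v z).
  by apply: L2_weighted => // z; rewrite ger0_norm.
have La := L2_accepted Lx; have Lr := L2_rejected Lx.
have iwv := L2_integrableM Lwv Lv.
have iav := L2_integrableM La Lv.
have eqw : (\int[mu]_z (w z * x (psi z) ^+ 2)%:E = \int[mu]_z (w z * v z * v z)%:E)%E.
  rewrite (balanced_integral_psi mx2)//.
  by apply: eq_integral => z _; rewrite /v /=; congr EFin; ring.
have iw2 : mu.-integrable [set: E] (EFin \o (fun z => w z * x (psi z) ^+ 2)).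
  apply/integrableP; split.
    apply/measurable_EFinP; apply: measurable_funM => //.
    exact: (mx_psi mx2).
  have -> : (\int[mu]_z `|(w z * x (psi z) ^+ 2)%:E|
      = \int[mu]_z (w z * x (psi z) ^+ 2)%:E)%E.
    by apply: eq_integral => z _; rewrite gee0_abs// lee_fin mulr_ge0// sqr_ge0.
  by rewrite eqw; exact: integrable_lty.
have jE : (fun z => w z * jump_sqr x z)
    = (fun z => (w z * v z * v z + w z * x (psi z) ^+ 2) + (- 2) * (accepted x z * v z)).
  by apply/funext => z; rewrite /jump_sqr /accepted /v /=; ring.
have i1 : mu.-integrable [set: E]
    (EFin \o (fun z => w z * v z * v z + w z * x (psi z) ^+ 2)).
  exact: (integrableD measurableT iwv iw2).
have i2 : mu.-integrable [set: E] (EFin \o (fun z => (- 2) * (accepted x z * v z))).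
  exact: (integrableZl measurableT (- 2) iav).
split; first by rewrite jE; exact: (integrableD measurableT i1 i2).
rewrite jE RintegralD// RintegralD// RintegralZl//.
have -> : \int[mu]_z (w z * x (psi z) ^+ 2) = inner mu (fun z => w z * v z) v.
  exact: (congr1 fine eqw).
rewrite -[LHS](inner_comp mxi xi_inv)//; last first.
  by apply: L2_comp => //; exact: L2_P2op.
have -> : Qop xi (P2op idfun xi psi w x) \o xi = P2op idfun xi psi w x.
  by apply/funext => z; rewrite /Qop /= xiK.
rewrite innerC inner_P2op// -[inner mu x x](inner_comp mxi xi_inv)//.
have -> : inner mu (x \o xi) (x \o xi)
    = inner mu (rejected x) v + inner mu (fun z => w z * v z) v.
  rewrite -innerDl//; congr inner; apply/funext => z.
  by rewrite addrfctE /rejected /v /=; ring.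
have -> : \int[mu]_z (w z * v z * v z) = inner mu (fun z => w z * v z) v by [].
have -> : \int[mu]_z (accepted x z * v z) = inner mu (accepted x) v by [].
by rewrite -/v; field.
Qed.

End one_weight.

Lemma P2op_dirichlet_le w1 w2 x : balanced w1 -> balanced w2 ->
  (forall z, w2 z <= w1 z) -> L2 mu x ->
  inner mu x (Qop xi (P2op idfun xi psi w1 x))
    <= inner mu x (Qop xi (P2op idfun xi psi w2 x)).
Proof.
move=> b1 b2 w21 Lx.
have [i1 ->] := dirichlet_integrable b1 Lx.
have [i2 ->] := dirichlet_integrable b2 Lx.
rewrite lerD2l lerN2 ler_pM2l ?invr_gt0//; apply: le_Rintegral => // z _.
by apply: ler_wpM2r => //; exact: sqr_ge0.
Qed.

End involutive_metropolis.

(** * Admissible acceptance functions yield balanced weights *)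

Section acceptance_ratio.
Context (d : measure_display) (E : measurableType d) (R : realType).
Variables (mu : probability E R) (xi psi : E -> E) (nu : {measure set E -> \bar R}).
Variables (g1 g2 : E -> R).
Hypothesis mxi : measurable_fun [set: E] xi.
Hypothesis mpsi : measurable_fun [set: E] psi.
Hypothesis tauK : forall x, xi (psi (xi (psi x))) = x.
Hypothesis nuE : forall A, measurable A ->
  nu A = (mu A + mu ((xi \o psi) @^-1` A))%E.
Hypothesis mg1 : measurable_fun [set: E] g1.
Hypothesis g1_ge0 : forall x, 0 <= g1 x.
Hypothesis mg2 : measurable_fun [set: E] g2.
Hypothesis g2_ge0 : forall x, 0 <= g2 x.
Hypothesis g1E : forall A, measurable A -> mu A = (\int[nu]_(x in A) (g1 x)%:E)%E.
Hypothesis g2E : forall A, measurable A ->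
  mu ((xi \o psi) @^-1` A) = (\int[nu]_(x in A) (g2 x)%:E)%E.

Let tau := xi \o psi.

Let mtau : measurable_fun [set: E] tau.
Proof. exact: measurableT_comp. Qed.

Let mtauV A : measurable A -> measurable (tau @^-1` A).
Proof. by move=> mA; rewrite -[X in measurable X]setTI; exact: mtau. Qed.

Let tauVK A : tau @^-1` (tau @^-1` A) = A.
Proof. by apply/seteqP; split => x; rewrite /tau /= tauK. Qed.

(** The involution [tau] exchanges the two summands of [nu]. *)
Let nu_inv A : measurable A -> nu (tau @^-1` A) = nu A.
Proof.
move=> mA; rewrite nuE ?nuE//; last exact: mtauV.
by rewrite -/tau tauVK addeC.
Qed.

Lemma rratio_ge0 z : 0 <= rratio g1 g2 z.
Proof. by rewrite /rratio; case: ifP => // _; exact: divr_ge0. Qed.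

Lemma measurable_rratio : measurable_fun [set: E] (rratio g1 g2).
Proof.
(* The inverse becomes a real power, whose measurability is known; the two agree because [g1] is
   nonnegative. *)
have -> : rratio g1 g2 =
    fun z => if (0 < g1 z) && (0 < g2 z) then g2 z * (g1 z `^ (-1)) else 0.
  by apply/funext => z; rewrite /rratio powR_inv1.
apply: measurable_fun_ifT => //.
  by apply: measurable_and; exact: measurable_fun_ltr.
apply: measurable_funM => //.
exact: (measurableT_comp (measurable_powR _)).
Qed.

(** [tau] preserves [nu] and exchanges [mu] with its image, so it exchanges their densities, by
    almost-everywhere uniqueness; integrability comes from total mass 1. *)
Lemma densities_swap : {ae nu, forall z, g1 z = g2 (tau z) /\ g2 z = g1 (tau z)}.
Proof.
have i1 : nu.-integrable [set: E] (fun x => (g1 x)%:E).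
  apply/integrableP; split; first exact/measurable_EFinP.
  under eq_integral do rewrite gee0_abs ?lee_fin//.
  by rewrite -g1E// probability_setT ltry.
have i2 : nu.-integrable [set: E] (fun x => (g2 x)%:E).
  apply/integrableP; split; first exact/measurable_EFinP.
  under eq_integral do rewrite gee0_abs ?lee_fin//.
  by rewrite -g2E// preimage_setT probability_setT ltry.
have mgt (g : E -> R) : measurable_fun setT g ->
    measurable_fun [set: E] (fun x => (g (tau x))%:E).
  by move=> mg; apply/measurable_EFinP; exact: measurableT_comp.
have swap (g : E -> R) A : measurable A -> measurable_fun setT g ->
    (\int[nu]_(x in A) (g (tau x))%:E = \int[nu]_(x in tau @^-1` A) (g x)%:E)%E.
  move=> mA mg; have mA' := mtauV mA; rewrite -{1}(tauVK A).
  rewrite (@integral_comp_preserving _ _ _ nu tau _ (fun x => (g x)%:E))//.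
  exact/measurable_EFinP.
have e1 : ae_eq nu [set: E] (fun x => (g1 x)%:E) (fun x => (g2 (tau x))%:E).
  apply: integral_ae_eq => //; first exact: mgt.
  move=> A _ mA; rewrite swap// -g1E// -g2E; last exact: mtauV.
  by rewrite -/tau tauVK.
have e2 : ae_eq nu [set: E] (fun x => (g2 x)%:E) (fun x => (g1 (tau x))%:E).
  apply: integral_ae_eq => //; first exact: mgt.
  by move=> A _ mA; rewrite -g2E// (swap g1)// -g1E//; exact: mtauV.
apply: filterS2 e1 e2 => z /(_ I) + /(_ I).
by move=> [->] [->].
Qed.

(** With respect to [nu], the weighted measure has density [g1 * phi (g2 / g1)]. The identity
    [r * phi r^-1 = phi r] makes it symmetric in [g1] and [g2], which [tau] swaps. *)
Lemma admissible_balanced phi : admissible phi ->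
  balanced mu xi psi (phi \o rratio g1 g2).
Proof.
move=> [mphi [phi01 [phiV phi0]]].
have mw : measurable_fun [set: E] (phi \o rratio g1 g2).
  apply: (measurable_comp _ _ mphi measurable_rratio).
    exact: measurable_itv.
  by move=> _ [z _ <-] /=; rewrite in_itv/= rratio_ge0.
have w01 z : 0 <= (phi \o rratio g1 g2) z <= 1 by apply: phi01; exact: rratio_ge0.
split => // h h0 mh.
pose w := phi \o rratio g1 g2.
have w0 z : 0 <= w z by have /andP[] := w01 z.
have dens (k : E -> \bar R) : (forall z, (0 <= k z)%E) -> measurable_fun setT k ->
    (\int[mu]_z ((w z)%:E * k z) = \int[nu]_z ((g1 z * w z)%:E * k z))%E.
  move=> k0 mk; rewrite (@ge0_integral_density _ _ _ nu mu g1)//.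
  - by apply: eq_integral => z _; rewrite muleA -EFinM.
  - by move=> z; rewrite mule_ge0// lee_fin.
  - by apply: emeasurable_funM => //; exact/measurable_EFinP.
have mht : measurable_fun [set: E] (fun z => h (tau z)) by exact: measurableT_comp.
have mgw : measurable_fun [set: E] (fun z => (g1 z * w z)%:E).
  by apply/measurable_EFinP; exact: measurable_funM.
rewrite (dens (fun z => h (xi (psi z))))// dens//.
rewrite -[RHS](@integral_comp_preserving _ _ _ nu tau setT
  (fun z => (g1 z * w z)%:E * h z)%E)//; last exact: emeasurable_funM.
rewrite preimage_setT; apply: ae_eq_integral => //.
- exact: emeasurable_funM.
- exact: (measurableT_comp (emeasurable_funM mgw mh)).
apply: filterS densities_swap => z [e1 e2] _; congr (_%:E * _)%E.
rewrite /w /= /rratio -e1 -e2.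
(* Where a density vanishes, both ratios are 0 by convention, and [phi 0 = 0] makes both sides 0. *)
have [p1|n1] := boolP (0 < g1 z); last first.
  by rewrite /= andbF phi0 !mulr0.
have [p2|n2] := boolP (0 < g2 z); last by rewrite /= phi0 !mulr0.
rewrite /= -(phiV (g2 z / g1 z)) ?divr_gt0// invf_div.
by rewrite mulrA mulrCA divff ?mulr1// gt_eqF.
Qed.

End acceptance_ratio.

(** * Maximality of [min(1, r)] among admissible functions *)

Lemma minphi_admissible (R : realType) : admissible (@minphi R).
Proof.
split; first by apply: measurable_minr => //.
split; first by move=> r r0; rewrite /minphi ge_min lexx le_min ler01 r0.
split; last by rewrite /minphi minEle ler10.
move=> r r0; rewrite /minphi minr_pMr ?mulr1 ?divff ?gt_eqF// ?ltW//.
exact: minC.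
Qed.

(** For [r > 0], [phi r = r * phi r^-1 <= r] because [phi] is at most 1. *)
Lemma admissible_le_minphi (R : realType) (phi : R -> R) (r : R) :
  admissible phi -> 0 <= r -> phi r <= minphi r.
Proof.
move=> [_ [phi01 [phiV phi0]]] r0; have /andP[_ phir1] := phi01 r r0.
rewrite /minphi le_min phir1 /=; move: r0; rewrite le_eqVlt => /predU1P[<-|r0].
  by rewrite phi0.
rewrite -phiV// ler_piMr//; first exact: ltW.
have rV0 : 0 <= r^-1 by rewrite invr_ge0 ltW.
by have /andP[] := phi01 r^-1 rV0.
Qed.

(** * The asymptotic variance as a Neumann series on pairs *)

Section asymptotic_variance.
Context (d : measure_display) (E : measurableType d) (R : realType).
Variables (mu : {measure set E -> \bar R}) (xi : E -> E) (lam : R).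
Hypothesis mxi : measurable_fun [set: E] xi.
Hypothesis xiK : involutive xi.
Hypothesis xi_inv : forall A, measurable A -> mu (xi @^-1` A) = mu A.
Hypothesis lam01 : 0 <= lam < 1.

Local Notation V := ((E -> R) * (E -> R))%type.

Definition pair_L2 (p : V) : Prop := L2 mu p.1 /\ L2 mu p.2.

Definition pair_inner (p q : V) : R := inner mu p.1 q.1 + inner mu p.2 q.2.

Definition pair_swap (p : V) : V := (p.2 \o xi, p.1 \o xi).

Definition pair_op (P1 P2 : (E -> R) -> (E -> R)) (p : V) : V := (P1 p.2, P2 p.1).

Definition L2_reversible_contraction (P : (E -> R) -> (E -> R)) : Prop :=
  [/\ forall f, L2 mu f -> L2 mu (P f), reversible mu xi P &
      forall f, L2 mu f -> inner mu (P f) (P f) <= inner mu f f].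

Let pL0 : pair_L2 0. Proof. by split; exact: L2_0. Qed.

Let pLD x y : pair_L2 x -> pair_L2 y -> pair_L2 (x + y).
Proof. by move=> [x1 x2] [y1 y2]; split; exact: L2D. Qed.

Let pLZ a x : pair_L2 x -> pair_L2 (a *: x).
Proof. by move=> [x1 x2]; split; exact: L2Z. Qed.

Let pC x y : pair_L2 x -> pair_L2 y -> pair_inner x y = pair_inner y x.
Proof. by move=> _ _; rewrite /pair_inner innerC [inner _ x.2 _]innerC. Qed.

Let pDl x y z : pair_L2 x -> pair_L2 y -> pair_L2 z ->
  pair_inner (x + y) z = pair_inner x z + pair_inner y z.
Proof.
by move=> [x1 x2] [y1 y2] [z1 z2]; rewrite /pair_inner !innerDl// addrACA.
Qed.

Let pZl a x z : pair_L2 x -> pair_L2 z ->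
  pair_inner (a *: x) z = a * pair_inner x z.
Proof.
by move=> [x1 x2] [z1 z2]; rewrite /pair_inner !innerZl// mulrDr.
Qed.

Let p_ge0 x : pair_L2 x -> 0 <= pair_inner x x.
Proof. by move=> _; rewrite addr_ge0// inner_ge0. Qed.

Let pJD x y : pair_swap (x + y) = pair_swap x + pair_swap y.
Proof. by []. Qed.

Let pJZ a x : pair_swap (a *: x) = a *: pair_swap x.
Proof. by []. Qed.

Let pJK : involutive pair_swap.
Proof.
by move=> [x y]; congr pair; apply/funext => z; rewrite /= xiK.
Qed.

Let pLJ x : pair_L2 x -> pair_L2 (pair_swap x).
Proof. by move=> [x1 x2]; split; exact: L2_comp. Qed.

Let pJ x y : pair_L2 x -> pair_L2 y ->
  pair_inner (pair_swap x) (pair_swap y) = pair_inner x y.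
Proof.
move=> [x1 x2] [y1 y2]; rewrite /pair_inner /= addrC.
by congr (_ + _); exact: inner_comp.
Qed.

Lemma pair_op_reversible_contraction P1 P2 :
  L2_reversible_contraction P1 -> L2_reversible_contraction P2 ->
  reversible_contraction pair_L2 pair_inner pair_swap (pair_op P1 P2).
Proof.
move=> [P1L P1r P1le] [P2L P2r P2le]; split.
- by move=> x [x1 x2]; split; [exact: P1L|exact: P2L].
- move=> x y [x1 x2] [y1 y2]; rewrite /pair_inner /= addrC.
  by rewrite (P2r _ _ x1 y2) (P1r _ _ x2 y1).
- move=> x [x1 x2]; rewrite /pair_inner /= addrC.
  by apply: lerD; [exact: P2le|exact: P1le].
Qed.

(** Two steps return each component to its slot, with the operators composed in opposite orders. *)
Lemma iter_pair_op P1 P2 (f g : E -> R) k :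
  iter k.*2 (pair_op P1 P2) (f, g) = (iter k (P1 \o P2) f, iter k (P2 \o P1) g).
Proof. by elim: k => //= k ->. Qed.

Section one_pair.
Variables (P1 P2 : (E -> R) -> (E -> R)) (fb : E -> R).
Hypothesis P1c : L2_reversible_contraction P1.
Hypothesis P2c : L2_reversible_contraction P2.
Hypothesis Lfb : L2 mu fb.

Local Notation P := (pair_op P1 P2).
Local Notation F := ((fb, fb) : V).

Let Pc := pair_op_reversible_contraction P1c P2c.
Let LF : pair_L2 F. Proof. by split. Qed.

Let LiP k : pair_L2 (iter k P F).
Proof. exact: (iter_mem Pc LF). Qed.

Definition pair_moment (k : nat) : R := pair_inner F (iter k P F).

Lemma pair_moment_le k : `|pair_moment k| <= pair_inner F F.
Proof.
apply: (@form_norm_le _ _ pair_L2 pair_inner) => //.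
exact: (iter_form_le Pc LF).
Qed.

Lemma pair_inner_resolvent_sum N :
  pair_inner F (resolvent_sum lam P F N) = \sum_(k < N) lam ^+ k * pair_moment k.
Proof.
elim: N => [|N IH].
  rewrite /resolvent_sum !big_ord0 pC// -(scale0r 0) pZl// mul0r//.
rewrite /resolvent_sum !big_ord_recr -/(resolvent_sum lam P F N) /=.
have LX : pair_L2 (resolvent_sum lam P F N).
  exact: (resolvent_sum_mem pL0 pLD pLZ lam Pc LF).
rewrite pC// ?pDl// ?pZl//; try by [apply: pLD => //; apply: pLZ]; try exact: pLZ.
by rewrite pC// IH [pair_inner (iter _ _ _) _]pC.
Qed.

(* [kop] is only additive up to null sets; additivity against a test function
   follows from reversibility. *)
Lemma inner_iter_linear (Q1 Q2 : (E -> R) -> (E -> R)) (a : R) u v h k :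
  L2_reversible_contraction Q1 -> L2_reversible_contraction Q2 ->
  L2 mu u -> L2 mu v -> L2 mu h ->
  inner mu h (iter k (Q1 \o Q2) (fun x => u x + a * v x))
  = inner mu h (iter k (Q1 \o Q2) u) + a * inner mu h (iter k (Q1 \o Q2) v).
Proof.
move=> [Q1L Q1r _] [Q2L Q2r _] Lu Lv Lh.
have Lit w j : L2 mu w -> L2 mu (iter j (Q1 \o Q2) w).
  by move=> Lw; elim: j => //= j; move=> /Q2L/Q1L.
have Luv : L2 mu (fun x => u x + a * v x) := L2D Lu (L2Z a Lv).
(* The test function is generalized: each step moves the outermost [Q1] and [Q2] onto it as
   adjoints. *)
elim: k h Lh => [|k IH] h Lh.
  rewrite /= ![inner mu h _]innerC -innerZl// -innerDl//.
  exact: L2Z.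
pose adj (Q : (E -> R) -> (E -> R)) (g : E -> R) := Qop xi (Q (Qop xi g)).
have Ladj (Q : (E -> R) -> (E -> R)) g :
    (forall f, L2 mu f -> L2 mu (Q f)) -> L2 mu g -> L2 mu (adj Q g).
  by move=> QL Lg; apply: L2_comp => //; apply: QL; exact: L2_comp.
have step w : L2 mu w ->
    inner mu h (iter k.+1 (Q1 \o Q2) w) = inner mu (adj Q2 (adj Q1 h)) (iter k (Q1 \o Q2) w).
  move=> Lw; rewrite iterS /= innerC Q1r//; last by apply: Q2L; exact: Lit.
  by rewrite Q2r// 1?innerC//; [exact: Lit|exact: Ladj].
by rewrite !step// IH//; exact: (Ladj _ _ Q2L (Ladj _ _ Q1L Lh)).
Qed.

Definition varl_term (k : nat) : R :=
  lam ^+ (2 * k) * inner mu fb (iter k (P1 \o P2) (fun x => fb x + lam * P1 fb x))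
  + lam ^+ (2 * k) * inner mu fb (iter k (P2 \o P1) (fun x => fb x + lam * P2 fb x)).

(** The [fb] parts form the moment of order [2k], the [lam] parts that of order [2k + 1]; hence [n]
    summands of the variance are [2n] Neumann terms. *)
Lemma varl_termE k : varl_term k =
  lam ^+ k.*2 * pair_moment k.*2 + lam ^+ k.*2.+1 * pair_moment k.*2.+1.
Proof.
have [P1L _ _] := P1c; have [P2L _ _] := P2c.
rewrite /varl_term !inner_iter_linear//; try by [exact: P1L|exact: P2L].
rewrite /pair_moment iterSr -[P F]/(P1 fb, P2 fb) !iter_pair_op /pair_inner /=.
by rewrite mul2n exprS; ring.
Qed.

Lemma sum_varl_term n :
  \sum_(0 <= k < n) varl_term k = pair_inner F (resolvent_sum lam P F n.*2).
Proof.
rewrite pair_inner_resolvent_sum; elim: n => [|n IH].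
  by rewrite big_nil big_ord0.
by rewrite big_nat_recr//= doubleS !big_ord_recr/= IH varl_termE addrA.
Qed.

(** Convergence is what gives [limn] its meaning. Moments are at most [pair_inner F F] and both
    exponents are at least [n], whence a geometric majorant. *)
Lemma is_cvg_varl_series : cvgn (fun n => \sum_(0 <= k < n) varl_term k).
Proof.
have /andP[lam0 lam1] := lam01.
apply: (normed_cvg (u_ := varl_term)).
apply: (@series_le_cvg _ _ (geometric (2 * pair_inner F F) lam)).
- by move=> n /=; exact: normr_ge0.
- by move=> n; rewrite /geometric/= mulr_ge0 ?exprn_ge0// mulr_ge0// p_ge0.
- move=> n; rewrite /geometric/= varl_termE.
  have m0 := pair_moment_le n.*2; have m1 := pair_moment_le n.*2.+1.
  have e0 : 0 <= lam ^+ n.*2 <= lam ^+ n.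
    by rewrite exprn_ge0//= -addnn exprD ler_piMr ?exprn_ge0// exprn_ile1// ltW.
  have e1 : 0 <= lam ^+ n.*2.+1 <= lam ^+ n.
    rewrite exprn_ge0//= exprS (le_trans (ler_piMl _ _))//; last 2 first.
      - exact: ltW.
      - by case/andP: e0.
    by case/andP: e0.
  apply: le_trans (ler_normD _ _) _; rewrite !normrM.
  move: e0 e1 => /andP[a0 a1] /andP[b0 b1]; rewrite (ger0_norm a0) (ger0_norm b0).
  have h0 := ler_pM a0 (normr_ge0 _) a1 m0; have h1 := ler_pM b0 (normr_ge0 _) b1 m1.
  by apply: le_trans (lerD h0 h1) _; rewrite le_eqVlt; apply/orP; left; apply/eqP; ring.
- by apply: is_cvg_geometric_series; rewrite ger0_norm.
Qed.

End one_pair.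

(** The partial sums are ordered up to an error of order [lam ^+ n.*2], which vanishes in the
    limit. *)
Lemma varl_le (P1 P2 P2' : (E -> R) -> (E -> R)) (f : E -> R) :
  L2_reversible_contraction P1 -> L2_reversible_contraction P2 ->
  L2_reversible_contraction P2' ->
  (forall x, L2 mu x -> inner mu x (Qop xi (P2 x)) <= inner mu x (Qop xi (P2' x))) ->
  L2 mu (fun x => f x - mean mu f) -> {ae mu, forall x, Qop xi f x = f x} ->
  varl mu lam P1 P2 f <= varl mu lam P1 P2' f.
Proof.
move=> P1c P2c P2c' P2le Lfb Qf; have /andP[lam0 lam1] := lam01.
rewrite /varl; set fb := fun x => f x - mean mu f; rewrite lerD2r.
pose F : V := (fb, fb).
have LF : pair_L2 F by split.
(* [F] is fixed by the swap only almost everywhere, so its invariance is expressed through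
   pairings. *)
have JF x : pair_L2 x -> pair_inner F (pair_swap x) = pair_inner F x.
  move=> [x1 x2]; rewrite /pair_inner /= addrC.
  have fbJ u : L2 mu u -> inner mu fb (u \o xi) = inner mu fb u.
    move=> Lu; rewrite -(inner_comp mxi xi_inv Lfb Lu).
    apply: inner_ae_eql => //; try exact: L2_comp.
    by apply: filterS Qf => z; rewrite /Qop /fb /= => ->.
  by rewrite !fbJ.
have c := is_cvg_varl_series P1c P2c Lfb.
have c' := is_cvg_varl_series P1c P2c' Lfb.
pose C := 8%:R * ((1 - lam)^-1 * pair_inner F F).
pose err n : R := lam ^+ n.*2 * C.
have err0 : err n @[n --> \oo] --> 0.
  have -> : err = geometric C (lam ^+ 2).
    by apply/funext => n; rewrite /err /geometric/= mulrC -mul2n exprM.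
  by apply: cvg_geometric; rewrite ger0_norm ?exprn_ge0// exprn_ilt1.
apply: (ler_cvg_to c (_ : _ --> _)).
  rewrite -[X in _ --> X]addr0; apply: cvgD; [exact: c'|exact: err0].
apply: nearW => n.
rewrite [leRHS](_ : _ = \sum_(0 <= k < n) varl_term P1 P2' fb k + err n)//.
rewrite -/(varl_term P1 P2 fb) (sum_varl_term P1c P2c Lfb).
rewrite (sum_varl_term P1c P2c' Lfb) /err.
apply: (resolvent_sum_le pL0 pLD pLZ pC pDl pZl p_ge0 pJD pJZ pJK pLJ pJ) => //.
- exact: pair_op_reversible_contraction.
- exact: pair_op_reversible_contraction.
(* The form splits into a [P2] block and a [P1] block; the latter is common to both sides. *)
- move=> x [x1 x2]; rewrite /pair_inner /=.
  by rewrite lerD2r; exact: P2le.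
Qed.

End asymptotic_variance.

(** * Ordering of the variances by the acceptance function *)

Unset Implicit Arguments.

Theorem theorem3p8 (d : measure_display) (E : measurableType d) (R : realType)
  (mu : probability E R) (xi psi : E -> E) (nu : {measure set E -> \bar R})
  (g1 g2 : E -> R) (K : R.-pker E ~> E) (phi1 phi2 : R -> R)
  (f : E -> R) (lam : R) :
  measurable_fun [set: E] xi ->
  (forall x, xi (xi x) = x) ->
  (forall A, measurable A -> mu (xi @^-1` A) = mu A) ->
  measurable_fun [set: E] psi ->
  (forall x, psi (xi (psi (xi x))) = x) ->
  (forall x, xi (psi (xi (psi x))) = x) ->
  (forall A, measurable A -> nu A = (mu A + mu ((xi \o psi) @^-1` A))%E) ->
  measurable_fun [set: E] g1 -> (forall x, 0 <= g1 x) ->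
  measurable_fun [set: E] g2 -> (forall x, 0 <= g2 x) ->
  (forall A, measurable A -> mu A = (\int[nu]_(x in A) (g1 x)%:E)%E) ->
  (forall A, measurable A -> mu ((xi \o psi) @^-1` A) = (\int[nu]_(x in A) (g2 x)%:E)%E) ->
  admissible phi1 -> admissible phi2 ->
  (forall r, 0 <= r -> phi2 r <= phi1 r) ->
  reversible mu xi (kop K) ->
  L2 mu f -> {ae mu, forall x, Qop xi f x = f x} ->
  0 <= lam < 1 ->
  varl mu lam (kop K) (P2op phi1 xi psi (rratio g1 g2)) f
    <= varl mu lam (kop K) (P2op phi2 xi psi (rratio g1 g2)) f
  /\
  varl mu lam (kop K) (P2op (@minphi R) xi psi (rratio g1 g2)) f
    <= varl mu lam (kop K) (P2op phi2 xi psi (rratio g1 g2)) f.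
Proof.
move=> mxi xiK xi_inv mpsi _ tauK nuE mg1 g1_ge0 mg2 g2_ge0 g1E g2E.
move=> a1 a2 phi21 Krev Lf Qf lam01.
have Kc : L2_reversible_contraction mu xi (kop K).
  split=> //.
  - by move=> h; exact: (kop_L2 mxi xiK xi_inv Krev).
  - by move=> h; exact: (inner_kop_le mxi xiK xi_inv Krev).
have bal phi : admissible phi ->
    balanced mu xi psi (phi \o rratio g1 g2).
  by move=> a; exact: (admissible_balanced mxi mpsi tauK nuE mg1 g1_ge0 mg2 g2_ge0 g1E g2E a).
have Pc phi : admissible phi ->
    L2_reversible_contraction mu xi (P2op phi xi psi (rratio g1 g2)).
  move=> /bal b; split.
  - by move=> h; exact: (L2_P2op mxi xiK xi_inv mpsi b).
  - exact: (P2op_reversible mxi xiK xi_inv mpsi tauK b).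
  - by move=> h; exact: (inner_P2op_le mxi xiK xi_inv mpsi b).
have muy : (mu [set: E] < +oo)%E by rewrite probability_setT ltry.
have Lfb : L2 mu (fun x => f x - mean mu f).
  have Lc : L2 mu (cst (- mean mu f)) := L2_cst _ muy.
  exact: (L2D Lf Lc).
(* Both conclusions compare [phi2] with an admissible function above it: [phi1], then [minphi]. *)
have le phi : admissible phi -> (forall r, 0 <= r -> phi2 r <= phi r) ->
    varl mu lam (kop K) (P2op phi xi psi (rratio g1 g2)) f
    <= varl mu lam (kop K) (P2op phi2 xi psi (rratio g1 g2)) f.
  move=> a phi2_le.
  apply: (varl_le mxi xiK xi_inv lam01) => //; try exact: Pc.
  move=> x Lx.
  apply: (P2op_dirichlet_le mxi xiK xi_inv mpsi (bal _ a) (bal _ a2)) => //.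
  by move=> z; apply: phi2_le; exact: rratio_ge0.
split; first exact: le.
by apply: le; [exact: minphi_admissible|move=> r; exact: admissible_le_minphi].
Qed.
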